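(* Let $\mathcal{X},\mathcal{Y}$ be Hilbert modules over a pro-$C^*$-algebra $\mathcal{A}$ and let $T,L\in Hom^*_{\mathcal{A}}(\mathcal{X},\mathcal{Y})$. Then the following are equivalent: (i) $TT^*\le LL^*$; (ii) $\bar p_{\mathcal{X}}(T^*\xi)\le \bar p_{\mathcal{X}}(L^*\xi)$ for all $\xi\in\mathcal{Y}$ and all $p\in S(\mathcal{A})$.
   Context: A pro-$C^*$-algebra $\mathcal{A}$ is a complete Hausdorff topological $*$-algebra whose topology is given by its family $S(\mathcal{A})$ of continuous $C^*$-seminorms. A Hilbert $\mathcal{A}$-module is a left $\mathcal{A}$-module with an $\mathcal{A}$-valued inner product, complete for the seminorms $\bar p_{\mathcal{X}}(\xi)=\sqrt{p(\langle\xi,\xi\rangle)}$, $p\in S(\mathcal{A})$. $Hom^*_{\mathcal{A}}(\mathcal{X},\mathcal{Y})$ denotes adjointable bounded $\mathcal{A}$-module maps. For self-adjoint $S,R\in Hom^*_{\mathcal{A}}(\mathcal{Y})$, $S\le R$ means $\langle (R-S)\xi,\xi\rangle\ge 0$ in $\mathcal{A}$ for all $\xi\in\mathcal{Y}$. *)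

(* Defs.v *)
From HB Require Import structures.
From mathcomp Require Import all_boot all_order all_algebra.
From mathcomp Require Import complex.
From mathcomp Require Import reals.
Set Implicit Arguments. Unset Strict Implicit. Unset Printing Implicit Defensive.
Import Order.TTheory GRing.Theory Num.Theory.
Local Open Scope ring_scope.

Section ProCStar.
Variable R : realType.
Local Notation C := (R[i]).

Definition seminorm (V : lmodType C) (p : V -> R) : Prop :=
  [/\ forall x, 0 <= p x,
      forall x y, p (x + y) <= p x + p y &
      forall (c : C) x, p (c *: x) = Normc.normc c * p x].

Definition net_complete (V : zmodType) (F : (V -> R) -> Prop) : Prop :=
  forall (I : Type) (le : I -> I -> Prop),
    inhabited I ->
    (forall i, le i i) ->
    (forall i j k, le i j -> le j k -> le i k) ->
    (forall i j, exists k, le i k /\ le j k) ->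
    forall x : I -> V,
      (forall p, F p -> forall e : R, 0 < e ->
         exists i0, forall i j, le i0 i -> le i0 j -> p (x i - x j) < e) ->
      exists l : V, forall p, F p -> forall e : R, 0 < e ->
         exists i0, forall i, le i0 i -> p (x i - l) < e.

(* q is continuous for the locally convex topology generated by F *)
Definition dominated (V : zmodType) (F : (V -> R) -> Prop) (q : V -> R) : Prop :=
  exists (n : nat) (ps : 'I_n -> V -> R) (c : R),
    (forall i, F (ps i)) /\ forall x, q x <= c * \sum_(i < n) ps i x.

Record star_algebra (A : lmodType C) (mul : A -> A -> A) (star : A -> A) : Prop := {
  mulA : forall a b c, mul a (mul b c) = mul (mul a b) c;
  mulDl : forall a b c, mul (a + b) c = mul a c + mul b c;
  mulDr : forall a b c, mul a (b + c) = mul a b + mul a c;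
  mulZl : forall (z : C) a b, mul (z *: a) b = z *: mul a b;
  mulZr : forall (z : C) a b, mul a (z *: b) = z *: mul a b;
  starK : forall a, star (star a) = a;
  starD : forall a b, star (a + b) = star a + star b;
  starZ : forall (z : C) a, star (z *: a) = z^* *: star a;
  starM : forall a b, star (mul a b) = mul (star b) (star a)
}.

Definition cstar_seminorm (A : lmodType C) (mul : A -> A -> A) (star : A -> A)
  (p : A -> R) : Prop :=
  [/\ seminorm p,
      forall a b, p (mul a b) <= p a * p b &
      forall a, p (mul (star a) a) = p a ^+ 2].

(* A pro-C*-algebra: a complete Hausdorff topological *-algebra whose topology
   is given by the family S of its continuous C*-seminorms.  S generates the
   topology, and (saturation) S contains every C*-seminorm continuous for it. *)
Record pro_cstar (A : lmodType C) (mul : A -> A -> A) (star : A -> A)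
  (S : (A -> R) -> Prop) : Prop := {
  pc_alg : star_algebra mul star;
  pc_cstar : forall p, S p -> cstar_seminorm mul star p;
  pc_saturated : forall q, cstar_seminorm mul star q -> dominated S q -> S q;
  pc_hausdorff : forall a, (forall p, S p -> p a = 0) -> a = 0;
  pc_complete : net_complete S
}.

Definition positive (A : lmodType C) (mul : A -> A -> A) (star : A -> A) (a : A) : Prop :=
  exists b, a = mul (star b) b.

Definition hnorm (A X : lmodType C) (ip : X -> X -> A) (p : A -> R) (x : X) : R :=
  Num.sqrt (p (ip x x)).

Record hilbert_module (A : lmodType C) (mul : A -> A -> A) (star : A -> A)
  (S : (A -> R) -> Prop) (X : lmodType C) (act : A -> X -> X) (ip : X -> X -> A)
  : Prop := {
  actM : forall a b x, act (mul a b) x = act a (act b x);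
  actDl : forall a b x, act (a + b) x = act a x + act b x;
  actDr : forall a x y, act a (x + y) = act a x + act a y;
  actZl : forall (z : C) a x, act (z *: a) x = z *: act a x;
  actZr : forall (z : C) a x, act a (z *: x) = z *: act a x;
  ipDl : forall x y w, ip (x + y) w = ip x w + ip y w;
  ipZl : forall (z : C) x y, ip (z *: x) y = z *: ip x y;
  ipAl : forall a x y, ip (act a x) y = mul a (ip x y);
  ip_star : forall x y, star (ip x y) = ip y x;
  ip_pos : forall x, positive mul star (ip x x);
  ip_def : forall x, ip x x = 0 -> x = 0;
  hm_complete : net_complete (fun q => exists p, S p /\ q = hnorm ip p)
}.

Definition is_adjoint (A X Y : lmodType C) (ipX : X -> X -> A) (ipY : Y -> Y -> A)
  (T : X -> Y) (Ts : Y -> X) : Prop :=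
  forall x y, ipY (T x) y = ipX x (Ts y).

Definition hom_star (A : lmodType C) (S : (A -> R) -> Prop)
  (X Y : lmodType C) (actX : A -> X -> X) (ipX : X -> X -> A)
  (actY : A -> Y -> Y) (ipY : Y -> Y -> A) (T : X -> Y) : Prop :=
  [/\ forall x y, T (x + y) = T x + T y,
      forall (z : C) x, T (z *: x) = z *: T x,
      forall a x, T (actX a x) = actY a (T x),
      forall p, S p -> exists M : R, 0 <= M /\
         forall x, hnorm ipY p (T x) <= M * hnorm ipX p x &
      exists Ts : Y -> X, is_adjoint ipX ipY T Ts].

Definition op_le (A : lmodType C) (mul : A -> A -> A) (star : A -> A)
  (Y : lmodType C) (ipY : Y -> Y -> A) (S1 S2 : Y -> Y) : Prop :=
  forall y, positive mul star (ipY (S2 y - S1 y) y).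

End ProCStar.

(* Main.v *)
Require Import Defs.
From HB Require Import structures.
From mathcomp Require Import all_boot all_order all_algebra.
From mathcomp Require Import complex.
From mathcomp Require Import reals.
From mathcomp Require Import boolp classical_sets.
From mathcomp Require Import ring lra.
Set Implicit Arguments.
Unset Strict Implicit.
Unset Printing Implicit Defensive.
Import Order.TTheory GRing.Theory Num.Theory.
Local Open Scope ring_scope.
Local Open Scope complex_scope.

(* Everything happens in a unital *-algebra with a C*-seminorm [q], complete or not, where
   a self-adjoint [x] is called positive when [q (t - x) <= t] for some [t >= 0].  The
   iteration [w -> (w^2 + x) / 2] yields approximate square roots that are polynomials in the
   given element; with them one gets that squares and commuting products of positive
   elements are positive, that [q] is monotone on positive elements, and, through
   [c* c + c c* >= 0], that every [b* b] is positive.  This applies to the unitization of the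
   pro-C*-algebra, normed by left multiplication, for each [p] in [S].
   Put [a = <T* y, T* y>] and [b = <L* y, L* y>].  Monotonicity gives (i) -> (ii).  Conversely,
   replacing [y] by [d y] turns (ii) into [p (d a d^* ) <= p (d b d^* )] for all [d] in the
   unitization; with [d] near [(b + eps)^(-1/2)] this gives [a <= b + eps] for each [p].
   Approximate positive square roots of [b - a] are unique up to the error, hence form a
   Cauchy net, and their limit [c] satisfies [c* c = b - a]. *)

(** * A decision procedure for noncommutative ring identities *)

Section NoncommutativeIdentities.
Variable U : pzRingType.

Inductive ncexpr :=
  NCvar of nat | NCzero | NCone | NCadd of ncexpr & ncexpr | NCopp of ncexpr
  | NCmul of ncexpr & ncexpr.

Fixpoint nceval (s : seq U) (e : ncexpr) : U :=
  match e with
  | NCvar i => nth 0 s i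
  | NCzero => 0
  | NCone => 1
  | NCadd a b => nceval s a + nceval s b
  | NCopp a => - nceval s a
  | NCmul a b => nceval s a * nceval s b
  end.

(* A normal form is a list of signed words in the atoms; [true] is a minus sign. *)
Fixpoint ncnorm (e : ncexpr) : seq (bool * seq nat) :=
  match e with
  | NCvar i => [:: (false, [:: i])]
  | NCzero => [::]
  | NCone => [:: (false, [::])]
  | NCadd a b => ncnorm a ++ ncnorm b
  | NCopp a => [seq (~~ w.1, w.2) | w <- ncnorm a]
  | NCmul a b => [seq (x.1 (+) y.1, x.2 ++ y.2) | x <- ncnorm a, y <- ncnorm b]
  end.

Definition ncword (s : seq U) (w : seq nat) : U := \prod_(i <- w) nth 0 s i.

Lemma nceval_norm s e :
  nceval s e = \sum_(w <- ncnorm e) (-1) ^+ w.1 * ncword s w.2.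
Proof.
elim: e => [i|||a IHa b IHb|a IHa|a IHa b IHb] /=.
- by rewrite big_seq1 mul1r /ncword big_seq1.
- by rewrite big_nil.
- by rewrite big_seq1 mul1r /ncword big_nil.
- by rewrite big_cat IHa IHb.
- by rewrite big_map IHa -sumrN; apply: eq_bigr => w _; rewrite signrN mulNr.
- rewrite big_allpairs_dep /= IHa IHb big_distrl; apply: eq_bigr => x _ /=.
  rewrite big_distrr; apply: eq_bigr => y _ /=; rewrite signr_addb /ncword big_cat /=.
  by rewrite -!mulrA; congr (_ * _); rewrite !mulrA; congr (_ * _); apply: commr_sign.
Qed.

Lemma nc_eq s e1 e2 :
  (let l := ncnorm (NCadd e1 (NCopp e2)) in
   perm_eq [seq w.2 | w <- l & ~~ w.1] [seq w.2 | w <- l & w.1]) ->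
  nceval s e1 = nceval s e2.
Proof.
move=> /= h; apply/eqP; rewrite -subr_eq0; apply/eqP.
rewrite -[LHS]/(nceval s (NCadd e1 (NCopp e2))) nceval_norm /=.
set l := (X in \sum_(w <- X) _); rewrite (bigID (fun w => w.1)) /= addrC.
rewrite -[X in X + _]big_filter -[X in _ + X]big_filter.
have part c (t : seq (bool * seq nat)) : all (fun w => w.1 == c) t ->
    \sum_(w <- t) (-1) ^+ w.1 * ncword s w.2 =
    (-1) ^+ c * \sum_(w <- [seq w.2 | w <- t]) ncword s w.
  move=> /allP ht; rewrite big_map big_distrr /= big_seq [in RHS]big_seq.
  by apply: eq_bigr => w /ht /eqP ->.
rewrite (part false) ?(part true).
- by rewrite (perm_big _ h) /= mul1r mulN1r subrr.
- by apply/allP => w; rewrite mem_filter => /andP[->].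
- by apply/allP => w; rewrite mem_filter => /andP[/negPf ->].
Qed.
End NoncommutativeIdentities.

Ltac nc_mem x s :=
  lazymatch s with
  | nil => constr:(false)
  | x :: _ => constr:(true)
  | _ :: ?s' => nc_mem x s'
  end.

Ltac nc_index x s :=
  lazymatch s with
  | x :: _ => constr:(0%N)
  | _ :: ?s' => let i := nc_index x s' in constr:(i.+1)
  end.

Ltac nc_atoms e s :=
  lazymatch e with
  | ?a + ?b => let s' := nc_atoms a s in nc_atoms b s'
  | - ?a => nc_atoms a s
  | ?a * ?b => let s' := nc_atoms a s in nc_atoms b s'
  | 0 => s
  | 1 => s
  | _ => lazymatch nc_mem e s with true => s | false => constr:(e :: s) end
  end.

Ltac nc_reify e s :=
  lazymatch e with
  | ?a + ?b => let x := nc_reify a s in let y := nc_reify b s in constr:(NCadd x y)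
  | - ?a => let x := nc_reify a s in constr:(NCopp x)
  | ?a * ?b => let x := nc_reify a s in let y := nc_reify b s in constr:(NCmul x y)
  | 0 => constr:(NCzero)
  | 1 => constr:(NCone)
  | _ => let i := nc_index e s in constr:(NCvar i)
  end.

Ltac ncring :=
  lazymatch goal with
  | |- @eq ?T ?a ?b =>
    let s := nc_atoms a (@nil T) in
    let s := nc_atoms b s in
    let x := nc_reify a s in
    let y := nc_reify b s in
    apply: (@nc_eq _ s x y); vm_compute; reflexivity
  end.

(** * C*-seminorms *)

Lemma normc_real (R : rcfType) (r : R) : Normc.normc r%:C = `|r|.
Proof. by rewrite /= expr0n /= addr0 sqrtr_sqr. Qed.

Lemma conjC_real (R : rcfType) (r : R) : (r%:C)^*%R = r%:C.
Proof. by apply/CrealP/complex_realP; exists r. Qed.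

Lemma normc_ge0 (R : rcfType) (z : R[i]) : 0 <= Normc.normc z.
Proof. by case: z => a b; apply: sqrtr_ge0. Qed.

Lemma conjC_i (R : rcfType) : (0 +i* 1 : R[i])^*%R = - (0 +i* 1).
Proof. by apply/eqP; rewrite eq_complex /= oppr0 !eqxx. Qed.

Lemma mulC_ii (R : rcfType) : (0 +i* 1) * (0 +i* 1) = -1 :> R[i].
Proof. by apply/eqP; rewrite eq_complex /=; apply/andP; split; apply/eqP; ring. Qed.

Lemma normc_conj (R : rcfType) (z : R[i]) : Normc.normc z^*%R = Normc.normc z.
Proof. by case: z => a b /=; rewrite sqrrN. Qed.

Lemma scale_realD (R : realType) (V : lmodType R[i]) (r s : R) (x : V) :
  (r + s)%:C *: x = r%:C *: x + s%:C *: x.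
Proof. by rewrite -scalerDl rmorphD. Qed.

Lemma scale_realM (R : realType) (V : lmodType R[i]) (r s : R) (x : V) :
  (r * s)%:C *: x = r%:C *: (s%:C *: x).
Proof. by rewrite scalerA rmorphM. Qed.

Lemma exists_small_inv (R : realType) (e : R) : 0 < e -> exists n : nat, n.+1%:R^-1 < e.
Proof.
move=> e0; exists (Num.bound e^-1).
rewrite invf_plt ?posrE ?ltr0Sn //.
apply: (lt_trans (archi_boundP _)); first by rewrite invr_ge0 ltW.
by rewrite ltr_nat.
Qed.

(** Taking roots kills a factor that grows linearly in the exponent. If [x = y (1 + d)] with
    [d > 0], the bound at [k.+1] and the square of Bernoulli's inequality at [2 ^ k] give
    [2 ^ k * d ^+ 2 <= 2 * K] for all [k]. *)
Lemma le_of_sqr_powers (R : realType) (x y K : R) : 0 <= x -> 0 < y -> 0 <= K ->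
  (forall k : nat, x ^+ (2 ^ k) <= y ^+ (2 ^ k) * (1 + (2 ^ k)%:R * K)) -> x <= y.
Proof.
move=> x0 y0 K0 H; rewrite leNgt; apply/negP => yx.
pose d := x / y - 1.
have d0 : 0 < d by rewrite subr_gt0 ltr_pdivlMr // mul1r.
have xE : x = y * (1 + d) by rewrite /d addrC subrK mulrC divfK // gt_eqF.
have bern n : 1 + n%:R * d <= (1 + d) ^+ n.
  elim: n => [|n IH]; first by rewrite mul0r addr0 expr0.
  rewrite exprS; apply: (@le_trans _ _ ((1 + d) * (1 + n%:R * d))); last first.
    by rewrite ler_pM2l //; lra.
  have : 0 <= n%:R * d * d by rewrite !mulr_ge0 ?ler0n ?ltW.
  by rewrite -natr1; lra.
have small k : (2 ^ k)%:R * d ^+ 2 <= 2 * K.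
  have := H k.+1; rewrite xE exprMn ler_pM2l ?exprn_gt0 // expnS mulnC exprM natrM.
  have m0 : 0 < (2 ^ k)%:R :> R by rewrite ltr0n expn_gt0.
  move: (bern (2 ^ k)%N); set m := _%:R in m0 *; set z := _ ^+ (2 ^ k) => h1 h2.
  have md0 : 0 < m * d by rewrite mulr_gt0.
  have : (1 + m * d) ^+ 2 <= z ^+ 2.
    by rewrite ler_pXn2r ?nnegrE // ?(le_trans _ h1) // addr_ge0 // ltW.
  by move=> h3; rewrite -(ler_pM2l m0); lra.
have [n hn] : exists n : nat, 2 * K / d ^+ 2 < n%:R.
  by exists (Num.bound (2 * K / d ^+ 2)); apply: archi_boundP; rewrite !mulr_ge0 ?invr_ge0 ?sqr_ge0.
move: hn; rewrite ltr_pdivrMr ?exprn_gt0 // ltNge => /negP; apply.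
apply: le_trans (small n); rewrite ler_wpM2r ?sqr_ge0 // ler_nat ltnW //.
exact: ltn_expl.
Qed.

Section Seminorms.
Variables (R : realType) (V : lmodType R[i]) (p : V -> R).
Hypothesis hp : seminorm p.

Lemma snorm_ge0 x : 0 <= p x. Proof. by case: hp. Qed.
Lemma ler_snormD x y : p (x + y) <= p x + p y. Proof. by case: hp. Qed.
Lemma snormZ r x : p (r%:C *: x) = `|r| * p x.
Proof. by case: hp => _ _ ->; rewrite normc_real. Qed.
Lemma snormN x : p (- x) = p x.
Proof. by rewrite -scaleN1r -(rmorphN1 (real_complex R)) snormZ normrN1 mul1r. Qed.
Lemma snorm0 : p 0 = 0.
Proof. by rewrite -(scale0r 0) -(rmorph0 (real_complex R)) snormZ normr0 mul0r. Qed.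
Lemma snormB x y : p (x - y) = p (y - x).
Proof. by rewrite -snormN opprB. Qed.
Lemma ler_snormB x y : p (x - y) <= p x + p y.
Proof. by rewrite -(snormN y) ler_snormD. Qed.
Lemma ler_snorm_distD z x y : p (x - y) <= p (x - z) + p (z - y).
Proof. by have := ler_snormD (x - z) (z - y); rewrite addrA subrK. Qed.
Lemma ler_snorm_shift x y : p x <= p y + p (x - y).
Proof. by have := ler_snormD y (x - y); rewrite addrC subrK. Qed.
End Seminorms.

Section Cstar.
Variables (R : realType) (A : lmodType R[i]) (mul : A -> A -> A) (star : A -> A).
Hypothesis hA : star_algebra mul star.

Lemma star0 : star 0 = 0.
Proof. by rewrite -(scale0r 0) (starZ hA) conjC0 !scale0r. Qed.

Lemma starN a : star (- a) = - star a.
Proof. by rewrite -scaleN1r (starZ hA) conjCN1 scaleN1r. Qed.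

Lemma starB a b : star (a - b) = star a - star b.
Proof. by rewrite (starD hA) starN. Qed.

Lemma starZr (r : R) a : star (r%:C *: a) = r%:C *: star a.
Proof. by rewrite (starZ hA) conjC_real. Qed.

Lemma ler_snorm_star (p : A -> R) : seminorm p ->
  (forall a b, p (mul a b) <= p a * p b) ->
  (forall a, p a ^+ 2 <= p (mul (star a) a)) -> forall a, p a <= p (star a).
Proof.
move=> hp hM hC a; have [-> |nz] := eqVneq (p a) 0; first exact: snorm_ge0.
have a0 : 0 < p a by rewrite lt_neqAle eq_sym nz snorm_ge0.
by rewrite -(ler_pM2r a0) -expr2; apply: le_trans (hC a) (hM _ _).
Qed.

(** One inequality of the C*-identity suffices: it gives [p a <= p (star a)], hence [star] does not
    increase [p], and submultiplicativity yields the other inequality. *)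
Lemma cstar_seminorm_intro (p : A -> R) : seminorm p ->
  (forall a b, p (mul a b) <= p a * p b) ->
  (forall a, p a ^+ 2 <= p (mul (star a) a)) -> cstar_seminorm mul star p.
Proof.
move=> hp hM hC; split=> // a; apply/le_anti/andP; split=> //.
apply: le_trans (hM _ _) _; rewrite expr2 ler_wpM2r ?snorm_ge0 //.
by rewrite -{2}(starK hA a); apply: ler_snorm_star.
Qed.

Lemma snorm_star (p : A -> R) : cstar_seminorm mul star p -> forall a, p (star a) = p a.
Proof.
move=> [hs hM hC] a; have le_star : forall b, p b <= p (star b).
  by apply: ler_snorm_star => // b; rewrite hC.
by apply/le_anti; rewrite le_star -{2}(starK hA a) le_star.
Qed.
End Cstar.

Lemma cstar_seminorm_max (R : realType) (A : lmodType R[i]) (mul : A -> A -> A)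
    (star : A -> A) (p q : A -> R) : star_algebra mul star ->
  cstar_seminorm mul star p -> cstar_seminorm mul star q ->
  cstar_seminorm mul star (fun a => Num.max (p a) (q a)).
Proof.
move=> hA [hp pM pC] [hq qM qC].
have p0 := snorm_ge0 hp; have q0 := snorm_ge0 hq.
apply: cstar_seminorm_intro => //.
- split=> [x|x y|c x].
  + by rewrite le_max p0.
  + rewrite ge_max; apply/andP; split.
      by apply: le_trans (ler_snormD hp _ _) _; rewrite lerD // le_max lexx ?orbT.
    by apply: le_trans (ler_snormD hq _ _) _; rewrite lerD // le_max lexx ?orbT.
  + case: hp hq => _ _ pZ [_ _ qZ]; rewrite pZ qZ maxr_pMr //.
    exact: normc_ge0.
- move=> a b; rewrite ge_max; apply/andP; split.
    by apply: le_trans (pM _ _) _; rewrite ler_pM // le_max lexx ?orbT.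
  by apply: le_trans (qM _ _) _; rewrite ler_pM // le_max lexx ?orbT.
- move=> a; case: (leP (p a) (q a)) => _; first by rewrite -qC le_max lexx orbT.
  by rewrite -pC le_max lexx.
Qed.
(** * Positive elements for a C*-seminorm *)

Section Positivity.
Variables (R : realType) (U : algType R[i]) (star : U -> U) (q : U -> R).
Hypothesis hS : star_algebra *%R star.
Hypothesis hq : cstar_seminorm *%R star q.

Definition cst (r : R) : U := r%:C *: 1.
Definition sa (x : U) : Prop := star x = x.
(* For self-adjoint [x] in a C*-algebra, [q (t - x) <= t] says that the spectrum of
   [x] lies in [[0, 2 t]]. *)
Definition pos (x : U) : Prop := sa x /\ exists t, 0 <= t /\ q (cst t - x) <= t.

Let hs : seminorm q. Proof. by case: hq. Qed.
Let qM x y : q (x * y) <= q x * q y. Proof. by case: hq => _ + _; apply. Qed.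
Let qC x : q (star x * x) = q x ^+ 2. Proof. by case: hq => _ _; apply. Qed.
Let q_ge0 := snorm_ge0 hs.
Let qD := ler_snormD hs.
Let qB := ler_snormB hs.
Let qZ := snormZ hs.
Let q_star := snorm_star hS hq.

(** * Scalars, self-adjoint elements and their powers *)

Lemma star1 : star 1 = 1.
Proof. by have := starM hS (star 1) 1; rewrite !mulr1 (starK hS) mulr1. Qed.

Lemma q1_le1 : q 1 <= 1.
Proof.
have := qC 1; rewrite star1 mulr1 => h.
rewrite leNgt; apply/negP => h1; suff : q 1 < q 1 ^+ 2 by rewrite -h ltxx.
by rewrite expr2 ltr_pMr // (lt_trans ltr01).
Qed.

Lemma cstD r s : cst (r + s) = cst r + cst s.
Proof. exact: scale_realD. Qed.
Lemma cstM r x : cst r * x = r%:C *: x.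
Proof. by rewrite -scalerAl mul1r. Qed.
Lemma mulcst r x : x * cst r = r%:C *: x.
Proof. by rewrite -scalerAr mulr1. Qed.
Lemma cst_prod r s : cst (r * s) = cst r * cst s.
Proof. by rewrite cstM /cst scale_realM. Qed.
Lemma cstN r : cst (- r) = - cst r.
Proof. by rewrite /cst -scaleNr rmorphN. Qed.
Lemma cstB r s : cst (r - s) = cst r - cst s.
Proof. by rewrite cstD cstN. Qed.
Lemma cst0 : cst 0 = 0. Proof. by rewrite /cst scale0r. Qed.
Lemma cst1 : cst 1 = 1. Proof. by rewrite /cst scale1r. Qed.
Lemma cst_comm r x : cst r * x = x * cst r.
Proof. by rewrite cstM mulcst. Qed.
Lemma q_cst r : q (cst r) <= `|r|.
Proof. by rewrite qZ ler_piMr // q1_le1. Qed.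
Lemma q_cst_pos r : 0 <= r -> q (cst r) <= r.
Proof. by move=> r0; rewrite -{2}(ger0_norm r0) q_cst. Qed.

Lemma sa_cst r : sa (cst r). Proof. by rewrite /sa (starZr hS) star1. Qed.
Lemma sa1 : sa 1. Proof. exact: star1. Qed.
Lemma saD x y : sa x -> sa y -> sa (x + y).
Proof. by rewrite /sa (starD hS) => -> ->. Qed.
Lemma saN x : sa x -> sa (- x). Proof. by rewrite /sa (starN hS) => ->. Qed.
Lemma saB x y : sa x -> sa y -> sa (x - y).
Proof. by move=> hx hy; apply: saD => //; apply: saN. Qed.
Lemma saZ (r : R) x : sa x -> sa (r%:C *: x). Proof. by rewrite /sa (starZr hS) => ->. Qed.
Lemma saM x y : sa x -> sa y -> y * x = x * y -> sa (x * y).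
Proof. by rewrite /sa (starM hS) => -> ->. Qed.
Lemma saX x n : sa x -> sa (x ^+ n).
Proof.
move=> hx; elim: n => [|n IH]; first exact: sa1.
by rewrite exprS; apply: saM => //; rewrite -exprSr -exprS.
Qed.
Lemma sa_starM x : sa (star x * x). Proof. by rewrite /sa (starM hS) (starK hS). Qed.

Lemma q_sa_sqr x : sa x -> q (x * x) = q x ^+ 2.
Proof. by move=> hx; rewrite -qC hx. Qed.

(** The C*-identity iterates only along squarings, which is why exponents [2 ^ k] recur below. *)
Lemma q_sa_exp2 x k : sa x -> q (x ^+ (2 ^ k)) = q x ^+ (2 ^ k).
Proof.
move=> hx; elim: k => [|k IH]; first by rewrite !expr1.
by rewrite expnS mulnC !exprM [in LHS]expr2 q_sa_sqr ?IH //; apply: saX.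
Qed.

Lemma qX_le x n : (0 < n)%N -> q (x ^+ n) <= q x ^+ n.
Proof.
case: n => // n _; elim: n => [|n IH]; first by rewrite !expr1.
by rewrite exprS [X in _ <= X]exprS; apply: le_trans (qM _ _) _; rewrite ler_wpM2l.
Qed.

(** * The positive cone and approximate square roots *)

Lemma pos_large x : pos x -> exists t0, [/\ 0 <= t0 & forall t, t0 <= t -> q (cst t - x) <= t].
Proof.
move=> [_ [t0 [t00 h]]]; exists t0; split=> // t ht.
have -> : cst t - x = cst (t - t0) + (cst t0 - x) by rewrite addrA -cstD subrK.
apply: le_trans (qD _ _) _; have := @q_cst_pos (t - t0); lra.
Qed.

Lemma posD x y : pos x -> pos y -> pos (x + y).
Proof.
move=> [hx [t [t0 ht]]] [hy [s [s0 hs']]]; split; first exact: saD.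
exists (t + s); split; first lra.
by rewrite cstD opprD addrACA; apply: le_trans (qD _ _) _; lra.
Qed.

Lemma posZ (r : R) x : 0 <= r -> pos x -> pos (r%:C *: x).
Proof.
move=> r0 [hx [t [t0 ht]]]; split; first exact: saZ.
exists (r * t); split; first exact: mulr_ge0.
by rewrite cst_prod cstM -scalerBr qZ ger0_norm // ler_wpM2l.
Qed.

Lemma pos_bound x t : sa x -> q x <= t -> pos (cst t - x).
Proof.
move=> hx ht; split; first by apply: saB => //; apply: sa_cst.
by exists t; rewrite subKr; split=> //; apply: le_trans ht.
Qed.

Lemma pos_cst r : 0 <= r -> pos (cst r).
Proof.
by move=> r0; rewrite -[cst r]subr0; apply: pos_bound; rewrite ?(snorm0 hs) // /sa (star0 hS).
Qed.

(* The iteration whose limit is [1 - sqrt (1 - x)]. *)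
Fixpoint sqw (x : U) (n : nat) : U :=
  if n is m.+1 then (2^-1)%:C *: (sqw x m * sqw x m + x) else 0.

(** The scalar iteration at [x = 1], which increases to [1] and dominates the norms of [sqw x n]
    when [q x <= 1]. *)
Fixpoint omega (n : nat) : R := if n is m.+1 then 2^-1 * (omega m ^+ 2 + 1) else 0.

Lemma omegaS n : omega n.+1 = 2^-1 * (omega n ^+ 2 + 1). Proof. by []. Qed.

Lemma omega_bound n : 0 <= omega n <= 1.
Proof. by elim: n => [|n /andP[h1 h2]] /=; [rewrite lexx ler01|nra]. Qed.

(** The increments sum to at most [1], so they cannot all exceed [e]. A single small increment is
    all that the square root needs. *)
Lemma omega_small (e : R) : 0 < e -> exists n, omega n.+1 - omega n <= e.
Proof.
move=> e0; have [n hn] : exists n : nat, e^-1 < n%:R.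
  by exists (Num.bound e^-1); apply: archi_boundP; rewrite invr_ge0 ltW.
have h m : (exists n, omega n.+1 - omega n <= e) \/ m%:R * e <= omega m.
  elim: m => [|m [IH|IH]]; [by right; rewrite mul0r|by left|].
  case: (leP (omega m.+1 - omega m) e) => hm; first by left; exists m.
  by right; rewrite -natr1; lra.
case: (h n) => // hn2; exfalso.
move: hn; rewrite -div1r ltr_pdivrMr // ltNge => /negP; apply.
by apply: le_trans hn2 _; case/andP: (omega_bound n).
Qed.

Lemma sqwS x n : sqw x n.+1 = (2^-1)%:C *: (sqw x n * sqw x n + x). Proof. by []. Qed.

Lemma sqw_comm x y n : y * x = x * y -> y * sqw x n = sqw x n * y.
Proof.
move=> h; elim: n => [|n IH] /=; first by rewrite mulr0 mul0r.
by rewrite -scalerAr -scalerAl mulrDr mulrDl h mulrA IH -!mulrA IH.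
Qed.

Lemma sqw_sa x n : sa x -> sa (sqw x n).
Proof.
move=> h; elim: n => [|n IH] /=; first exact: (star0 hS).
by apply: saZ; apply: saD => //; apply: saM.
Qed.

Lemma q_sqw x n : q x <= 1 -> q (sqw x n) <= omega n.
Proof.
move=> hx; elim: n => [|n IH] /=; first by rewrite (snorm0 hs).
rewrite qZ ger0_norm ?invr_ge0 // ler_wpM2l ?invr_ge0 //.
apply: le_trans (qD _ _) _; apply: lerD => //; apply: le_trans (qM _ _) _.
by rewrite expr2 ler_pM.
Qed.

Lemma sqrB_noncomm (x y : U) : x * x - y * y = x * (x - y) + (x - y) * y.
Proof. by rewrite mulrBr mulrBl addrA subrK. Qed.

Lemma q_sqwB x n : q x <= 1 -> q (sqw x n.+1 - sqw x n) <= omega n.+1 - omega n.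
Proof.
move=> hx; elim: n => [|n IH].
  rewrite /= mulr0 add0r subr0 subr0 expr0n /= add0r qZ ger0_norm ?invr_ge0 //.
  by rewrite ler_wpM2l ?invr_ge0.
rewrite (sqwS x n.+1) {3}(sqwS x n) -scalerBr opprD addrACA subrr addr0.
rewrite qZ ger0_norm ?invr_ge0 //.
have -> : omega n.+2 - omega n.+1 = 2^-1 * ((omega n.+1 - omega n) * (omega n.+1 + omega n)).
  rewrite (omegaS n.+1); have := omegaS n; move: (omega n.+1) (omega n) => a b ->; ring.
rewrite ler_wpM2l ?invr_ge0 // sqrB_noncomm.
apply: le_trans (qD _ _) _; rewrite [X in _ <= X]mulrDr; apply: lerD.
  by apply: le_trans (qM _ _) _; rewrite mulrC ler_pM // q_sqw.
by apply: le_trans (qM _ _) _; rewrite ler_pM // q_sqw.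
Qed.

Lemma approx_sqrt h e : pos h -> 0 < e ->
  exists u, [/\ pos u, forall y, y * h = h * y -> y * u = u * y & q (h - u * u) <= e].
Proof.
move=> ph e0; have sh := ph.1; have [t0 [t00 ht]] := pos_large ph.
pose t := t0 + 1; have t1 : 0 < t by rewrite /t; lra.
have {}ht : q (cst t - h) <= t by apply: ht; rewrite /t; lra.
pose x := t^-1%:C *: (cst t - h).
have qx : q x <= 1.
  by rewrite qZ ger0_norm ?invr_ge0 ?(ltW t1) // mulrC ler_pdivrMr // mul1r.
have sx : sa x by apply: saZ; apply: saB => //; apply: sa_cst.
have hE : h = t%:C *: (1 - x).
  rewrite scalerBr -/(cst t) /x -scale_realM divff ?gt_eqF // scale1r.
  by rewrite opprB addrC subrK.
have [n hn] := omega_small (divr_gt0 e0 (mulr_gt0 (ltr0Sn R 1) t1)).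
pose w := sqw x n; pose r := Num.sqrt t.
have r0 : 0 <= r by apply: sqrtr_ge0.
exists (r%:C *: (1 - w)); split.
- apply: posZ => //; rewrite -cst1; apply: pos_bound; first exact: sqw_sa.
  by apply: le_trans (q_sqw _ qx) _; case/andP: (omega_bound n).
- move=> y hy; rewrite -scalerAr -scalerAl mulrBr mulrBl mulr1 mul1r sqw_comm //.
  by rewrite /x -scalerAr -scalerAl mulrBr mulrBl hy cst_comm.
- rewrite -scalerAl -scalerAr -scale_realM -expr2 sqr_sqrtr ?(ltW t1) // {1}hE.
  rewrite -scalerBr.
  have -> : 1 - x - (1 - w) * (1 - w) = 2%:R%:C *: (w - sqw x n.+1).
    rewrite /= -/w scalerBr -scale_realM divff ?pnatr_eq0 // scale1r.
    rewrite mulrBr mulr1 mulrBl mul1r (scale_realD 1 1) scale1r.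
    by ncring.
  rewrite !qZ (snormB hs) !ger0_norm ?(ltW t1) //.
  have := q_sqwB n qx; rewrite ler_pdivlMr ?mulr_gt0 // in hn; rewrite -/w => hw.
  rewrite mulrA; apply: le_trans hn; rewrite mulrC (mulrC 2).
  by rewrite ler_wpM2r // mulr_ge0 ?(ltW t1).
Qed.

(** * Squares, products and monotonicity of the norm *)

(** [u] is the real part of [v = u + i w], and [star v * v = u * u + w * w] since [u] and [w]
    commute; [v] and [star v] have equal norm. *)
Lemma q_sqr_leD u w : sa u -> sa w -> u * w = w * u -> q u ^+ 2 <= q (u * u + w * w).
Proof.
move=> su sw uw; pose j : R[i] := 0 +i* 1; pose v := u + j *: w.
have jc : j^*%R = - j := conjC_i R.
have jj : j * j = -1 := mulC_ii R.
have sv : star v = u - j *: w by rewrite (starD hS) (starZ hS) jc su sw scaleNr.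
have -> : u * u + w * w = star v * v.
  have -> : star v * v = u * u - (j *: w) * (j *: w) + (u * (j *: w) - j *: w * u).
    by rewrite sv /v; ncring.
  by rewrite -!scalerAl -!scalerAr scalerA jj scaleN1r opprK uw subrr addr0.
rewrite qC ler_pXn2r ?nnegrE //.
have := qD v (star v); rewrite q_star sv.
have -> : v + (u - j *: w) = 2%:C *: u by rewrite (scale_realD 1 1) scale1r /v; ncring.
by rewrite qZ ger0_norm //; lra.
Qed.

(** With [w * w] close to [t - g * g], the sum [w * w + g * g] is close to [t], so [q_sqr_leD]
    bounds [q w ^+ 2], which is [q (t - g * g)] up to the error. *)
Lemma pos_sqr_norm g t : sa g -> q g ^+ 2 <= t -> q (cst t - g * g) <= t.
Proof.
move=> sg gt; have t0 : 0 <= t by apply: le_trans gt; apply: sqr_ge0.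
apply/ler_addgt0Pr => e e0; have sgg : sa (g * g) by apply: saM.
have [||w [[sw _] wc hw]] := @approx_sqrt (cst t - g * g) (e / 2).
- by apply: pos_bound => //; rewrite q_sa_sqr.
- by rewrite divr_gt0.
have gw : w * g = g * w.
  by symmetry; apply: wc; rewrite mulrBr mulrBl mulrA cst_comm.
have h1 : q w ^+ 2 <= t + e / 2.
  apply: le_trans (q_sqr_leD sw sg gw) _.
  have -> : w * w + g * g = cst t - (cst t - g * g - w * w) by ncring.
  by apply: le_trans (qB _ _) _; apply: lerD => //; apply: q_cst_pos.
by apply: le_trans (ler_snorm_shift hs _ (w * w)) _; rewrite q_sa_sqr //; lra.
Qed.

Lemma pos_sqr g : sa g -> pos (g * g).
Proof.
move=> sg; split; first exact: saM.
by exists (q g ^+ 2); split; [apply: sqr_ge0|apply: pos_sqr_norm].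
Qed.

(** Every [t >= q h] is a valid witness in [pos]: [h] is close to a square, for which [pos_sqr_norm]
    gives this. *)
Lemma pos_norm h t : pos h -> q h <= t -> q (cst t - h) <= t.
Proof.
move=> ph ht; apply/ler_addgt0Pr => e e0.
have e3 : 0 < e / 3 by rewrite divr_gt0.
have [u [[su _] _ hu]] := approx_sqrt ph e3.
have qu : q u ^+ 2 <= t + e / 3.
  rewrite -q_sa_sqr //; apply: le_trans (ler_snorm_shift hs _ h) _.
  by rewrite (snormB hs); apply: lerD.
have := pos_sqr_norm su qu.
have -> : cst t - h = (cst (t + e / 3) - u * u) - (cst (e / 3) + (h - u * u)).
  by rewrite cstD; ncring.
move=> h1; apply: le_trans (qB _ _) _.
have := qD (cst (e / 3)) (h - u * u); have := q_cst_pos (ltW e3); lra.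
Qed.

(** Approximants within [1] of [h] share the witness [q h + 1] by [pos_norm], so the defining
    inequality passes to the limit. *)
Lemma pos_closed h : sa h ->
  (forall e, 0 < e -> exists h', pos h' /\ q (h - h') <= e) -> pos h.
Proof.
move=> sh H; split=> //; exists (q h + 1); split; first by have := q_ge0 h; lra.
apply/ler_addgt0Pr => e e0.
have [|h' [ph' hh]] := H (Num.min e 1); first by rewrite lt_min e0 ltr01.
move: hh; rewrite le_min => /andP[he h1].
have : q (cst (q h + 1) - h') <= q h + 1.
  apply: pos_norm => //; apply: le_trans (ler_snorm_shift hs _ h) _.
  by rewrite (snormB hs) lerD2l.
have -> : cst (q h + 1) - h = (cst (q h + 1) - h') - (h - h') by ncring.
by move=> h2; apply: le_trans (qB _ _) _; lra.
Qed.

(** Approximate roots [u] of [h] and [v] of [k] commute, so [h * k] is close to the square of the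
    self-adjoint [u * v]. *)
Lemma posM h k : pos h -> pos k -> h * k = k * h -> pos (h * k).
Proof.
move=> ph pk hk; apply: pos_closed => [|e e0].
  by apply: saM; [case: ph|case: pk|].
pose C := q k + q h + 1.
have C0 : 0 < C by rewrite /C; have := q_ge0 k; have := q_ge0 h; lra.
pose d := Num.min (e / C) 1.
have d0 : 0 < d by rewrite lt_min ltr01 andbT divr_gt0.
have [u [[su _] uc hu]] := approx_sqrt ph d0.
have [v [[sv _] vc hv]] := approx_sqrt pk d0.
have ku : k * u = u * k by apply: uc.
have uv : u * v = v * u by apply: vc.
exists ((u * v) * (u * v)); split; first by apply: pos_sqr; apply: saM.
have -> : u * v * (u * v) = u * u * (v * v).
  by rewrite -!mulrA; congr (_ * _); rewrite !mulrA uv.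
have -> : h * k - u * u * (v * v) = (h - u * u) * k + u * u * (k - v * v) by ncring.
have quu : q (u * u) <= q h + 1.
  apply: le_trans (ler_snorm_shift hs _ h) _; rewrite (snormB hs) lerD2l.
  by apply: le_trans hu _; rewrite ge_min lexx orbT.
have dC : d * C <= e by rewrite -ler_pdivlMr // ge_min lexx.
apply: le_trans dC; apply: le_trans (qD _ _) _.
have -> : d * C = d * q k + (q h + 1) * d by rewrite /C; ring.
by apply: lerD; apply: le_trans (qM _ _) _; apply: ler_pM.
Qed.

Lemma posX h n : pos h -> pos (h ^+ n).
Proof.
move=> ph; elim: n => [|n IH]; first by rewrite expr0 -cst1; apply: pos_cst.
by rewrite exprS; apply: posM => //; rewrite -exprSr -exprS.
Qed.

(** The product [(m - g) (m + g)] is positive; adding the square of its approximate root to [g * g]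
    gives nearly [m ^+ 2], and [q_sqr_leD] applies. *)
Lemma norm_le_of_pos g m : 0 <= m -> sa g -> pos (cst m - g) -> pos (cst m + g) -> q g <= m.
Proof.
move=> m0 sg p1 p2.
have : pos ((cst m - g) * (cst m + g)).
  by apply: posM => //; rewrite mulrBl mulrBr !mulrDl !mulrDr (cst_comm m g); ncring.
have -> : (cst m - g) * (cst m + g) = cst (m ^+ 2) - g * g.
  by rewrite expr2 cst_prod mulrBl !mulrDr (cst_comm m g); ncring.
move=> p3; rewrite -(@ler_pXn2r _ 2) ?nnegrE //; apply/ler_addgt0Pr => e e0.
have [w [[sw _] wc hw]] := approx_sqrt p3 e0.
have gw : g * w = w * g by apply: wc; rewrite mulrBr mulrBl mulrA cst_comm.
apply: le_trans (q_sqr_leD sg sw gw) _.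
have -> : g * g + w * w = cst (m ^+ 2) - (cst (m ^+ 2) - g * g - w * w) by ncring.
by apply: le_trans (qB _ _) _; apply: lerD => //; apply: q_cst_pos; apply: sqr_ge0.
Qed.

Lemma pos_le_norm h b : pos h -> pos (b - h) -> q h <= q b.
Proof.
move=> ph pb; have sb : sa b by rewrite -(subrK h b); apply: saD; [case: pb|case: ph].
apply: norm_le_of_pos => //; first by case: ph.
  have -> : cst (q b) - h = (cst (q b) - b) + (b - h) by rewrite addrA subrK.
  by apply: posD => //; apply: pos_bound.
by apply: posD => //; apply: pos_cst.
Qed.

(* [c c*] and [c* c] have the same spectrum up to [0]; here this is read off the powers
   [(theta - c* c)^n = theta^n - c* z_n c], with [z_n] built from [theta - c c*]. *)
Lemma q_swap c theta M : 0 <= theta <= M -> 0 < M ->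
  q (cst theta - c * star c) <= M -> q (cst theta - star c * c) <= M.
Proof.
move=> /andP[th0 thM] M0 hy; set x := cst theta - star c * c.
set y := cst theta - c * star c in hy.
have xc : x * star c = star c * y.
  by rewrite /x /y mulrBl mulrBr cst_comm mulrA.
have pw n : exists z, x ^+ n = cst (theta ^+ n) - star c * z * c /\ q z * M <= n%:R * M ^+ n.
  elim: n => [|n [z [xn hz]]].
    by exists 0; rewrite expr0 expr0 cst1 mulr0 mul0r subr0 (snorm0 hs) !mul0r.
  exists (cst (theta ^+ n) + y * z); split.
    rewrite exprS xn exprS cst_prod mulrBr !mulrA xc /x mulrBl -!mulrA.
    by rewrite -(cst_comm (theta ^+ n) c); ncring.
  have hyz : q (y * z) <= M * q z.
    by apply: le_trans (qM _ _) _; apply: ler_wpM2r.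
  have ht : q (cst (theta ^+ n)) <= M ^+ n.
    by apply: le_trans (q_cst_pos _) _; rewrite ?exprn_ge0 // lerXn2r ?nnegrE // ltW.
  apply: (@le_trans _ _ ((M ^+ n + M * q z) * M)).
    by apply: ler_wpM2r; [exact: ltW|apply: le_trans (qD _ _) _; apply: lerD].
  rewrite -natr1 mulrDl exprS; have := ler_wpM2l (ltW M0) hz; lra.
have K0 : 0 <= q c ^+ 2 / M by rewrite divr_ge0 ?sqr_ge0 // ltW.
apply: (@le_of_sqr_powers _ _ _ (q c ^+ 2 / M)) => // k.
have sx : sa x by apply: saB; [apply: sa_cst|apply: sa_starM].
rewrite -q_sa_exp2 //; move: (2 ^ k)%N => n.
have [z [-> hz]] := pw n; apply: le_trans (qB _ _) _.
rewrite mulrDr mulr1; apply: lerD.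
  by apply: le_trans (q_cst_pos _) _; rewrite ?exprn_ge0 // lerXn2r ?nnegrE // ltW.
have h1 : q (star c * z * c) <= q c ^+ 2 * q z.
  apply: le_trans (qM _ _) _; rewrite expr2 mulrAC ler_wpM2r //.
  by apply: le_trans (qM _ _) _; rewrite q_star.
apply: le_trans h1 _; rewrite -(ler_pM2r M0).
have -> : M ^+ n * (n%:R * (q c ^+ 2 / M)) * M = q c ^+ 2 * (n%:R * M ^+ n).
  by field; rewrite gt_eqF.
by rewrite -mulrA ler_wpM2l ?sqr_ge0.
Qed.

(** Up to the factor one half, this is the sum of the squares of the self-adjoint elements
    [c + star c] and [i (c - star c)]. *)
Lemma pos_starM_add_mulstar c : pos (star c * c + c * star c).
Proof.
pose j : R[i] := 0 +i* 1.
have jc : j^*%R = - j := conjC_i R.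
have jj : j * j = -1 := mulC_ii R.
have s1 : sa (c + star c) by rewrite /sa (starD hS) (starK hS) addrC.
have s2 : sa (j *: (c - star c)).
  by rewrite /sa (starZ hS) (starB hS) (starK hS) jc scaleNr -scalerN opprB.
have -> : star c * c + c * star c = (2^-1)%:C *: ((c + star c) * (c + star c)
    + (j *: (c - star c)) * (j *: (c - star c))).
  rewrite -scalerAl -scalerAr scalerA jj scaleN1r.
  have -> : (c + star c) * (c + star c) - (c - star c) * (c - star c) =
     2%:C *: (star c * c + c * star c) by rewrite (scale_realD 1 1) scale1r; ncring.
  by rewrite -scale_realM mulVf ?pnatr_eq0 // scale1r.
by apply: posZ; rewrite ?invr_ge0 //; apply: posD; apply: pos_sqr.
Qed.

(** [q_swap] with [theta = t0] and [M = t0 + tau] carries the lower bound [- tau] from [c * star c]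
    to [star c * c]; [tau > 0] keeps [M] positive. *)
Lemma pos_swap c tau : 0 < tau -> pos (cst tau + c * star c) -> pos (cst tau + star c * c).
Proof.
move=> tau0 /pos_large[t0 [t00 ht]]; split.
  by apply: saD; [apply: sa_cst|apply: sa_starM].
exists (t0 + tau); split; first lra.
have -> : cst (t0 + tau) - (cst tau + star c * c) = cst t0 - star c * c.
  by rewrite cstD; ncring.
apply: q_swap; [lra|lra|].
have -> : cst t0 - c * star c = cst (t0 + tau) - (cst tau + c * star c).
  by rewrite cstD; ncring.
by apply: ht; lra.
Qed.

(* If [k = t - b* b] had norm [s > t], then the norm of the positive-looking element
   [k^m (b* b)] would have to grow like [s^m], whereas it is bounded by [t^(m+1)]. *)
Lemma pos_starM b : pos (star b * b).
Proof.
set h := star b * b; have sh : sa h by apply: sa_starM.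
pose t := q b ^+ 2 + 1; have t0 : 0 < t by rewrite /t; have := sqr_ge0 (q b); lra.
have qh : q h <= t by rewrite qC /t; lra.
pose k := cst t - h; have pk : pos k by apply: pos_bound.
have sk : sa k by case: pk.
have hk : h * k = k * h by rewrite /k mulrBr mulrBl cst_comm.
have hkm m : h * k ^+ m = k ^+ m * h by apply: commrX.
have kS m : k ^+ m.+1 = cst t * k ^+ m - k ^+ m * h.
  by rewrite exprSr {2}/k mulrBr -cst_comm.
have fm m : pos (cst (t ^+ m.+1) - k ^+ m * h).
  elim: m => [|m IH]; first by rewrite expr1 expr0 mul1r.
  have -> : cst (t ^+ m.+2) - k ^+ m.+1 * h =
    t%:C *: (cst (t ^+ m.+1) - k ^+ m * h) + k ^+ m * (h * h).
    by rewrite (exprS t) cst_prod -cstM kS; ncring.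
  apply: posD; first by apply: posZ => //; apply: ltW.
  apply: posM; [exact: posX|exact: pos_sqr|].
  by rewrite mulrA -hkm -mulrA -hkm mulrA.
(* Evenness of [m] makes [k ^+ m * h] of the form [star c * c], and [m] being a power of two gives
   [q (k ^+ m) = s ^+ m] below. *)
have hn j : let m := (2 * 2 ^ j)%N in q (k ^+ m * h) <= t ^+ m.+1.
  move=> m; pose c := b * k ^+ (2 ^ j).
  have cE : star c * c = k ^+ m * h.
    by rewrite /c (starM hS) (saX _ sk) /m mul2n -addnn exprD -mulrA -hkm /h !mulrA.
  have tau0 : 0 < t ^+ m.+1 by apply: exprn_gt0.
  apply: norm_le_of_pos; [exact: ltW|by rewrite -cE; apply: sa_starM|exact: fm|].
  (* For the lower bound, [fm] and the positivity of [star c * c + c * star c] give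
     [c * star c >= - t ^+ m.+1]; [pos_swap] moves this to [star c * c]. *)
  rewrite -cE; apply: pos_swap => //.
  have -> : cst (t ^+ m.+1) + c * star c =
     cst (t ^+ m.+1) - star c * c + (star c * c + c * star c) by ncring.
  by apply: posD; [rewrite cE; apply: fm|apply: pos_starM_add_mulstar].
split=> //; exists t; split; first exact: ltW.
rewrite -/k leNgt; apply/negP => ts; set s := q k in ts.
have s0 : 0 < s by lra.
have K0 : 0 <= t / (s - t) by rewrite divr_ge0 ?subr_ge0 ?ltW.
have : s ^+ 2 <= t ^+ 2.
  apply: (@le_of_sqr_powers _ _ _ (t / (s - t))) => //; rewrite ?sqr_ge0 ?exprn_gt0 // => j.
  have := hn j; rewrite -!exprM; set m := (2 * 2 ^ j)%N => /= h1.
  have m0 : (0 < m)%N by rewrite muln_gt0 expn_gt0.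
  have qm : q (k ^+ m) = s ^+ m by rewrite /m -expnS q_sa_exp2.
  have h2 : q (k ^+ m.+1) <= t * s ^+ m + t ^+ m.+1.
    have -> : k ^+ m.+1 = t%:C *: k ^+ m - k ^+ m * h.
      by rewrite kS cstM.
    by apply: le_trans (qB _ _) _; rewrite qZ qm ger0_norm ?(ltW t0) // lerD2l.
  have h3 : q (k ^+ m.-1) <= s ^+ m.-1.
    by apply: qX_le; rewrite -subn1 subn_gt0 /m -expnS -{1}(expn0 2) ltn_exp2l.
  (* [m.+1] is not a power of two, so [2 m = m.+1 + m.-1] is used to bound [q (k ^+ m.+1)] from
     below. *)
  have h4 : s ^+ m * s ^+ m <= (t * s ^+ m + t ^+ m.+1) * s ^+ m.-1.
    have -> : s ^+ m * s ^+ m = q (k ^+ m.+1 * k ^+ m.-1).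
      rewrite -qm -expr2 -q_sa_sqr; last exact: saX.
      by rewrite -!exprD addSnnS prednK.
    by apply: le_trans (qM _ _) _; apply: ler_pM.
  have h5 : s ^+ m * s <= t * s ^+ m + t ^+ m.+1.
    by rewrite -(@ler_pM2r _ (s ^+ m.-1)) ?exprn_gt0 // -mulrA -exprS prednK.
  have h6 : s ^+ m <= t ^+ m * (t / (s - t)).
    by rewrite mulrA ler_pdivlMr ?subr_gt0 // -exprSr mulrBr lerBlDl (mulrC _ t).
  apply: le_trans h6 _; rewrite ler_wpM2l ?exprn_ge0 ?ltW //.
  have : 1 <= (2 ^ j)%:R :> R by rewrite ler1n expn_gt0.
  by move/(ler_wpM2r K0); lra.
by rewrite ler_pXn2r ?nnegrE ?(ltW s0) ?(ltW t0) // leNgt ts.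
Qed.

(** * Conjugation and uniqueness of square roots *)

Lemma pos_conj g y : pos g -> pos (star y * g * y).
Proof.
move=> pg; apply: pos_closed => [|e e0].
  by rewrite /sa !(starM hS) (starK hS) pg.1 mulrA.
have C0 : 0 < q y ^+ 2 + 1 by have := sqr_ge0 (q y); lra.
have [u [[su _] _ hu]] := approx_sqrt pg (divr_gt0 e0 C0).
exists (star (u * y) * (u * y)); split; first exact: pos_starM.
have -> : star y * g * y - star (u * y) * (u * y) = star y * (g - u * u) * y.
  by rewrite (starM hS) su; ncring.
apply: le_trans (qM _ _) _; apply: le_trans (ler_wpM2r (q_ge0 _) (qM _ _)) _.
rewrite q_star; apply: (@le_trans _ _ (q y ^+ 2 * (e / (q y ^+ 2 + 1)))).
  by rewrite expr2 mulrAC ler_wpM2l ?mulr_ge0.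
rewrite mulrA ler_pdivrMr // mulrC; have := sqr_ge0 (q y); nra.
Qed.

(** Positive roots are unique up to the error: the square of [u * u - v * v] minus the fourth power
    of [u - v] is [4 (u - v) u v (u - v)], which is positive, so the norms compare and the
    C*-identity turns powers into powers of norms. *)
Lemma sqr_norm_le u v : pos u -> pos v -> u * v = v * u ->
  q (u - v) ^+ 2 <= q (u * u - v * v).
Proof.
move=> pu pv uv; have su := pu.1; have sv := pv.1.
have sB : sa (u - v) by apply: saB.
pose P := (u - v) * (u * v) * (u - v).
have pP : pos P by rewrite /P -{1}sB; apply: pos_conj; apply: posM.
have e1 : u * u - v * v = (u - v) * (u + v) by rewrite mulrBl !mulrDr uv; ncring.
have e2 : u * u - v * v = (u + v) * (u - v) by rewrite mulrDl !mulrBr uv; ncring.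
have sX : sa (u * u - v * v) by apply: saB; apply: saM.
have sD : sa ((u - v) * (u - v)) by apply: saM.
have : q ((u - v) * (u - v) * ((u - v) * (u - v))) <= q ((u * u - v * v) * (u * u - v * v)).
  apply: pos_le_norm; first exact: pos_sqr.
  have -> : (u * u - v * v) * (u * u - v * v) - (u - v) * (u - v) * ((u - v) * (u - v)) =
     (P + P) + (P + P).
    pose Q := (u - v) * (v * u) * (u - v).
    have <- : P + Q + (P + Q) = P + P + (P + P) by rewrite /Q -uv.
    by rewrite {1}e1 e2 /P /Q; ncring.
  by do 2!apply: posD.
rewrite (q_sa_sqr sX) (q_sa_sqr sD) (q_sa_sqr sB).
by rewrite ler_pXn2r ?nnegrE ?sqr_ge0.
Qed.

(** * Approximate inverses, and the order recovered from norms of conjugates *)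

Lemma geometric_small (delta eta : R) : 0 < delta <= 1 -> 0 < eta ->
  exists n : nat, (1 - delta) ^+ n.+1 <= eta.
Proof.
move=> /andP[d0 d1] eta0.
have bern n : (1 - delta) ^+ n * (1 + n%:R * delta) <= 1.
  elim: n => [|n IH]; first by rewrite expr0 mul0r addr0 mulr1.
  apply: le_trans IH; rewrite exprSr -mulrA ler_wpM2l ?exprn_ge0 ?subr_ge0 //.
  by rewrite -natr1; have : 0 <= n%:R :> R by []; nra.
have [n hn] : exists n : nat, (delta * eta)^-1 < n%:R.
  by exists (Num.bound (delta * eta)^-1); apply: archi_boundP; rewrite invr_ge0 mulr_ge0 // ltW.
exists n; have n1 : 0 < 1 + n.+1%:R * delta.
  by rewrite addr_gt0 // mulr_gt0.
rewrite -(ler_pM2r n1); apply: le_trans (bern _) _.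
move: hn; rewrite -div1r ltr_pdivrMr ?mulr_gt0 // => /ltW hn.
apply: le_trans hn _; rewrite mulrA mulrDr mulr1 -natr1.
have : 0 < delta * eta by rewrite mulr_gt0.
lra.
Qed.

(** A truncated Neumann series: [b + eps = s (1 - x)], and the shift by [eps] gives
    [q x <= 1 - eps / s], below [1]. *)
Lemma approx_inv b eps eta : pos b -> 0 < eps -> 0 < eta ->
  exists z, [/\ pos z, forall y, y * b = b * y -> y * z = z * y &
    q ((b + cst eps) * z - 1) <= eta].
Proof.
move=> pb eps0 eta0; set e := b + cst eps; have sb := pb.1.
pose s := q b + eps + 1; have s0 : 0 < s by rewrite /s; have := q_ge0 b; lra.
pose x := (s^-1)%:C *: (cst s - e).
have xE : cst s - e = cst (s - eps) - b by rewrite cstB /e; ncring.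
have si : 0 <= s^-1 by rewrite invr_ge0 ltW.
have px : pos x.
  by apply: posZ => //; rewrite xE; apply: pos_bound => //; rewrite /s; lra.
have qx : q x <= 1 - eps / s.
  rewrite qZ ger0_norm // xE; have -> : 1 - eps / s = s^-1 * (s - eps).
    by field; rewrite gt_eqF.
  by rewrite ler_wpM2l // pos_norm // /s; lra.
have hd : 0 < eps / s <= 1.
  by rewrite divr_gt0 //= ler_pdivrMr // mul1r /s; have := q_ge0 b; lra.
have [n hn] := geometric_small hd eta0.
pose z := \sum_(i < n.+1) x ^+ i.
have pz : pos z.
  apply: (big_ind pos) => [|? ? ? ?|i _]; [|exact: posD|exact: posX].
  by rewrite -cst0; apply: pos_cst.
exists ((s^-1)%:C *: z); split; first exact: posZ.
- move=> y hy; rewrite -scalerAr -scalerAl; congr (_ *: _).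
  apply: commr_sum => i _; apply: commrX; rewrite /GRing.comm /x -scalerAr -scalerAl /e.
  by rewrite mulrBr mulrBl mulrDr mulrDl hy !cst_comm.
- have -> : e = s%:C *: (1 - x).
    rewrite scalerBr -/(cst s) /x -scale_realM divff ?gt_eqF // scale1r; ncring.
  rewrite -scalerAl -scalerAr -scale_realM divff ?gt_eqF // scale1r.
  have -> : (1 - x) * z - 1 = - x ^+ n.+1.
    have -> : (1 - x) * z = - ((x - 1) * z) by ncring.
    by rewrite -(subrX1 x n.+1) opprB addrAC subrr add0r.
  rewrite (snormN hs); apply: le_trans (qX_le _ _) _ => //; apply: le_trans hn.
  by rewrite lerXn2r ?nnegrE // (le_trans _ qx).
Qed.

(* With [d] close to [(b + eps)^(-1/2)], the hypothesis gives [d a d* <= 1 + eta];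
   conjugating back by [d (b + eps)] gives [a <= b + eps] up to a small error. *)
Lemma pos_sub_of_conj_norm a b : pos a -> pos b ->
  (forall d, q (d * a * star d) <= q (d * b * star d)) -> pos (b - a).
Proof.
move=> pa pb H; have sa_a := pa.1; have sb := pb.1.
apply: pos_closed => [|eps eps0]; first exact: saB.
pose e := b + cst eps; have se : sa e by apply: saD => //; apply: sa_cst.
exists (e - a); split; last first.
  have -> : b - a - (e - a) = - cst eps by rewrite /e; ncring.
  by rewrite (snormN hs) q_cst_pos // ltW.
apply: pos_closed => [|eta eta0]; first exact: saB.
(* In the final error the terms in [a] alone add up to at most [3 * r * q a] and those in [e] to at
   most [3 * r * q e]. *)
pose C := 3 * q e + 3 * q a + 1.
have C0 : 0 < C by rewrite /C; have := q_ge0 e; have := q_ge0 a; lra.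
pose r := Num.min 1 (eta / C).
have r0 : 0 < r by rewrite lt_min ltr01 divr_gt0.
have r1 : r <= 1 by rewrite ge_min lexx.
have rC : r * C <= eta by rewrite -ler_pdivlMr // ge_min lexx orbT.
have e10 : 0 < q e + 1 by have := q_ge0 e; lra.
have [z [pz zc hz]] := approx_inv pb eps0 (divr_gt0 r0 (ltr0Sn _ 1)).
have [|d [pd dc hd]] := @approx_sqrt z (r / 2 / (q e + 1)) pz; first by rewrite !divr_gt0.
have sd := pd.1.
have bd : b * d = d * b by apply: dc; apply: zc.
have ed : e * d = d * e by rewrite /e mulrDl mulrDr bd cst_comm.
(* [k] measures how far [d * d] is from an inverse of [e]; the errors of [approx_inv] and of the
   root contribute at most [r / 2] each. *)
pose k := e * d * d - 1.
have qk : q k <= r.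
  have -> : k = (e * z - 1) - e * (z - d * d) by rewrite /k; ncring.
  apply: le_trans (qB _ _) _; have -> : r = r / 2 + r / 2 by field.
  apply: lerD => //; apply: le_trans (qM _ _) _.
  apply: (@le_trans _ _ (q e * (r / 2 / (q e + 1)))); first by rewrite ler_wpM2l.
  rewrite mulrA ler_pdivrMr // mulrC ler_pM2l ?divr_gt0 //; lra.
have kE : e * d * d = 1 + k by rewrite /k; ncring.
have qdad : q (d * a * d) <= 1 + r.
  rewrite -{2}sd; apply: le_trans (H d) _; rewrite sd.
  have h1 : q (d * b * d) <= q (1 + k).
    rewrite -kE ed; apply: pos_le_norm; first by rewrite -{1}sd; apply: pos_conj.
    have -> : d * e * d - d * b * d = d * cst eps * d by rewrite /e; ncring.
    by rewrite -{1}sd; apply: pos_conj; apply: pos_cst; apply: ltW.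
  apply: le_trans h1 _; apply: le_trans (qD _ _) _; apply: lerD => //; exact: q1_le1.
have pdad : pos (cst (1 + r) - d * a * d).
  by apply: pos_bound => //; rewrite /sa !(starM hS) sd sa_a mulrA.
have su : star (d * e) = d * e by rewrite (starM hS) sd se.
exists (star (d * e) * (cst (1 + r) - d * a * d) * (d * e)); split; first exact: pos_conj.
(* Conjugating back, [d * e] cancels [d] up to [k]: the scalar term becomes [(1 + r) (1 + k) e] and
   the other one [(1 + k) a (1 + k)]. *)
have -> : e - a - star (d * e) * (cst (1 + r) - d * a * d) * (d * e) =
   k * a + a * k + k * a * k - (r%:C *: e + (1 + r)%:C *: (k * e)).
  rewrite su mulrBr mulrBl.
  have -> : d * e * cst (1 + r) * (d * e) = (1 + r)%:C *: ((1 + k) * e).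
    by rewrite -(cst_comm _ (d * e)) cstM -scalerAl -kE ed mulrA.
  have -> : d * e * (d * a * d) * (d * e) = (1 + k) * a * (1 + k).
    have kE' : 1 + k = d * d * e by rewrite -kE ed -mulrA ed mulrA.
    by rewrite {2}kE' -kE ed !mulrA.
  by rewrite (mulrDl 1 k e) mul1r scalerDr (scale_realD 1 r e) scale1r -!cstM; ncring.
have qa0 := q_ge0 a; have qe0 := q_ge0 e; have qk0 := q_ge0 k.
have qka : q (k * a) <= r * q a by apply: le_trans (qM _ _) _; apply: ler_wpM2r.
have qak : q (a * k) <= r * q a by apply: le_trans (qM _ _) _; rewrite mulrC; apply: ler_wpM2r.
have qkak : q (k * a * k) <= r * q a.
  apply: le_trans (qM _ _) _; rewrite -[X in _ <= X]mulr1; apply: ler_pM => //.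
  exact: le_trans r1.
have qke : q (k * e) <= r * q e by apply: le_trans (qM _ _) _; apply: ler_wpM2r.
have q1 : q ((1 + r)%:C *: (k * e)) <= 2 * (r * q e).
  by rewrite qZ ger0_norm; [apply: ler_pM => //|]; lra.
have q2 : q (r%:C *: e) = r * q e by rewrite qZ ger0_norm // ltW.
apply: le_trans (qB _ _) _; apply: le_trans rC.
have := qD (k * a + a * k) (k * a * k); have := qD (k * a) (a * k).
have := qD (r%:C *: e) ((1 + r)%:C *: (k * e)); rewrite /C; lra.
Qed.
End Positivity.

(** * Unitization *)

Section Unitization.
Variables (R : realType) (A : lmodType R[i]) (mul : A -> A -> A) (star : A -> A).
Hypothesis hA : star_algebra mul star.

(** The proof of the algebra laws is an argument of the type, so that the ring structure built from
    it can be attached to the type. *)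
Definition unitization of star_algebra mul star : Type := (A * R[i]^o)%type.
Local Notation U := (unitization hA).
HB.instance Definition _ := GRing.Lmodule.copy U (A * R[i]^o)%type.

Definition umul (x y : U) : U := (mul x.1 y.1 + x.2 *: y.1 + y.2 *: x.1, x.2 * y.2).
Definition uone : U := (0, 1).
Definition ustar (x : U) : U := (star x.1, x.2^*%R).
Definition uin (a : A) : U := (a, 0).
Definition uact (x : U) (y : A) : A := mul x.1 y + x.2 *: y.

Lemma mul0a a : mul 0 a = 0.
Proof. by rewrite -(scale0r 0) (Defs.mulZl hA) !scale0r. Qed.
Lemma mula0 a : mul a 0 = 0.
Proof. by rewrite -(scale0r 0) (Defs.mulZr hA) !scale0r. Qed.

Fact umulA : associative umul.
Proof.
move=> x y z; congr pair; rewrite /= ?mulrA //.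
rewrite !(Defs.mulDl hA) !(Defs.mulDr hA) !(Defs.mulZl hA) !(Defs.mulZr hA) (Defs.mulA hA).
rewrite !scalerDr !scalerA.
by rewrite !addrA (mulrC z.2 x.2) (mulrC z.2 y.2) [LHS](ACl (1*4*2*5*3*6*7)%AC).
Qed.
Fact umul1x : left_id uone umul.
Proof.
by move=> [a z]; rewrite /umul /= mul0a scale1r scaler0 add0r addr0 mul1r.
Qed.
Fact umulx1 : right_id uone umul.
Proof.
by move=> [a z]; rewrite /umul /= mula0 scale1r scaler0 !add0r mulr1.
Qed.
Fact umulDl : left_distributive umul +%R.
Proof.
move=> x y z; congr pair; rewrite /= ?mulrDl //.
by rewrite (Defs.mulDl hA) scalerDl scalerDr !addrA [LHS](ACl (1*3*5*2*4*6)%AC).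
Qed.
Fact umulDr : right_distributive umul +%R.
Proof.
move=> x y z; congr pair; rewrite /= ?mulrDr //.
by rewrite (Defs.mulDr hA) scalerDl scalerDr !addrA [LHS](ACl (1*3*5*2*4*6)%AC).
Qed.
Fact uone_neq0 : uone != 0.
Proof. by apply/eqP => -[] /eqP; rewrite oner_eq0. Qed.

HB.instance Definition _ := GRing.Zmodule_isNzRing.Build U
  umulA umul1x umulx1 umulDl umulDr uone_neq0.

Fact uscaleAl (c : R[i]) (x y : U) : c *: (x * y) = (c *: x) * y.
Proof.
congr pair; rewrite /= ?scalerAl //.
by rewrite !scalerDr (Defs.mulZl hA) !scalerA (mulrC c y.2).
Qed.
HB.instance Definition _ := GRing.Lmodule_isLalgebra.Build R[i] U uscaleAl.

Fact uscaleAr (c : R[i]) (x y : U) : c *: (x * y) = x * (c *: y).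
Proof.
congr pair; last by rewrite /= -[LHS]/(c * (x.2 * y.2)) mulrCA.
by rewrite /= !scalerDr (Defs.mulZr hA) !scalerA (mulrC c x.2).
Qed.
HB.instance Definition _ := GRing.Lalgebra_isAlgebra.Build R[i] U uscaleAr.

Lemma uinB a b : uin (a - b) = uin a - uin b.
Proof. by congr pair; rewrite /= subr0. Qed.
Lemma uinM a b : uin (mul a b) = uin a * uin b.
Proof. by congr pair; rewrite /= ?scale0r ?addr0 ?mulr0. Qed.
Lemma ustar_uin a : ustar (uin a) = uin (star a).
Proof. by rewrite /ustar /= conjC0. Qed.

Lemma ustar_algebra : star_algebra (A := U) *%R ustar.
Proof.
split.
- exact: mulrA.
- by move=> a b c; rewrite mulrDl.
- by move=> a b c; rewrite mulrDr.
- by move=> z a b; rewrite scalerAl.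
- by move=> z a b; rewrite scalerAr.
- by move=> [a z]; rewrite /ustar /= (Defs.starK hA) conjCK.
- by move=> a b; congr pair; rewrite /= ?(Defs.starD hA) ?rmorphD.
- by move=> z a; congr pair; rewrite /= ?(Defs.starZ hA) // -[LHS]/((z * a.2)^*%R) rmorphM.
- move=> a b; congr pair; rewrite /= ?rmorphM ?(mulrC b.2^*%R) //.
  by rewrite !(Defs.starD hA) (Defs.starM hA) !(Defs.starZ hA) addrAC.
Qed.

Lemma uactM x y a : uact (x * y) a = uact x (uact y a).
Proof.
rewrite /uact /= !(Defs.mulDl hA) !(Defs.mulZl hA) (Defs.mulDr hA) (Defs.mulZr hA) (Defs.mulA hA).
by rewrite scalerDr scalerA -!addrA; congr (_ + _); apply: addrCA.
Qed.

Lemma uactD x y a : uact (x + y) a = uact x a + uact y a.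
Proof. by rewrite /uact /= (Defs.mulDl hA) scalerDl addrACA. Qed.

Lemma uactZ c x a : uact (c *: x) a = c *: uact x a.
Proof. by rewrite /uact /= (Defs.mulZl hA) scalerDr scalerA. Qed.

Lemma uactZr x c a : uact x (c *: a) = c *: uact x a.
Proof. by rewrite /uact /= (Defs.mulZr hA) scalerDr !scalerA mulrC. Qed.

Lemma star_uact x y z : mul (star (uact x y)) z = mul (star y) (uact (ustar x) z).
Proof.
rewrite /uact /= (Defs.starD hA) (Defs.starM hA) (Defs.starZ hA).
rewrite (Defs.mulDl hA) (Defs.mulDr hA) (Defs.mulA hA).
by rewrite (Defs.mulZl hA) (Defs.mulZr hA).
Qed.

(** * The C*-seminorm of the unitization *)

Section Norm.
Variable p : A -> R.
Hypothesis hp : cstar_seminorm mul star p.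
Let hs : seminorm p. Proof. by case: hp. Qed.
Let pM a b : p (mul a b) <= p a * p b. Proof. by case: hp => _ + _; apply. Qed.
Let pC a : p (mul (star a) a) = p a ^+ 2. Proof. by case: hp => _ _; apply. Qed.
Let p_ge0 := snorm_ge0 hs.
Let pZ c a : p (c *: a) = Normc.normc c * p a. Proof. by case: hs => _ _; apply. Qed.

Definition opnorm (x : U) : R := sup [set p (uact x y) | y in [set y | p y <= 1]]%classic.
(** The operator norm can miss the scalar coordinate: if [A] has a unit [e], then [(- e, 1)] acts as
    [0]. The maximum keeps control of it. *)
Definition unorm (x : U) : R := Num.max (opnorm x) (Normc.normc (x.2 : R[i])).

Lemma p_uact_bound x y : p (uact x y) <= (p x.1 + Normc.normc (x.2 : R[i])) * p y.
Proof.
apply: le_trans (ler_snormD hs _ _) _; rewrite mulrDl pZ lerD2r; exact: pM.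
Qed.

Lemma opnorm_ub x y : p y <= 1 -> p (uact x y) <= opnorm x.
Proof.
move=> y1; apply: ub_le_sup; last by exists y.
exists (p x.1 + Normc.normc (x.2 : R[i])) => _ [z z1 <-].
apply: le_trans (p_uact_bound _ _) _; rewrite ler_piMr // addr_ge0 ?normc_ge0 //.
Qed.

Lemma opnorm_le x K : (forall y, p y <= 1 -> p (uact x y) <= K) -> opnorm x <= K.
Proof.
move=> H; apply: ge_sup; last by move=> _ [y y1 <-]; apply: H.
by exists (p (uact x 0)), 0; rewrite //= (snorm0 hs).
Qed.

Lemma opnorm_ge0 x : 0 <= opnorm x.
Proof. by apply: le_trans (@opnorm_ub x 0 _) => //; rewrite (snorm0 hs). Qed.

Lemma p_uact x y : p (uact x y) <= opnorm x * p y.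
Proof.
have [y0|ny] := eqVneq (p y) 0.
  by apply: le_trans (p_uact_bound _ _) _; rewrite y0 !mulr0.
have y0 : 0 < p y by rewrite lt_neqAle eq_sym ny p_ge0.
have := @opnorm_ub x ((p y)^-1%:C *: y).
rewrite uactZr !(snormZ hs) ger0_norm ?invr_ge0 // mulVf // => /(_ (lexx _)).
by rewrite mulrC ler_pdivrMr.
Qed.

(** For [p y <= 1], the C*-identity of [p] at [uact x y] and [star_uact] bound [p (uact x y) ^+ 2]
    by [p (uact (ustar x * x) y)], hence by [opnorm (ustar x * x)]. *)
Lemma opnorm_cstar : cstar_seminorm (A := U) *%R ustar opnorm.
Proof.
apply: cstar_seminorm_intro; first exact: ustar_algebra.
- have leZ c x : opnorm (c *: x) <= Normc.normc c * opnorm x.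
    apply: opnorm_le => y y1; rewrite uactZ pZ; apply: ler_wpM2l; first exact: normc_ge0.
    exact: opnorm_ub.
  split=> [x|x y|c x]; first exact: opnorm_ge0.
    apply: opnorm_le => z z1; rewrite uactD; apply: le_trans (ler_snormD hs _ _) _.
    by apply: lerD; apply: opnorm_ub.
  apply/le_anti; rewrite leZ /=.
  have [->|nc] := eqVneq c 0; first by rewrite Normc.normc0 mul0r opnorm_ge0.
  have c0 : 0 < Normc.normc c.
    rewrite lt_neqAle normc_ge0 andbT eq_sym; apply: contraNneq nc => /Normc.eq0_normc ->.
    exact: eqxx.
  have := leZ c^-1 (c *: x); rewrite scalerA mulVf // scale1r Normc.normcV.
  by rewrite mulrC ler_pdivlMr // mulrC.
- move=> x y; apply: opnorm_le => z z1; rewrite uactM.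
  apply: le_trans (p_uact _ _) _; apply: ler_wpM2l; first exact: opnorm_ge0.
  exact: opnorm_ub.
- move=> x; rewrite -[leRHS]sqr_sqrtr ?opnorm_ge0 //.
  rewrite ler_pXn2r ?nnegrE ?opnorm_ge0 ?sqrtr_ge0 //.
  apply: opnorm_le => y y1; rewrite -(ger0_norm (p_ge0 _)) -sqrtr_sqr ler_sqrt ?opnorm_ge0 //.
  rewrite -pC star_uact -uactM; apply: le_trans (pM _ _) _; rewrite (snorm_star hA hp).
  apply: le_trans (ler_piMl (p_ge0 _) y1) _; exact: opnorm_ub.
Qed.

Lemma snd_cstar : cstar_seminorm (A := U) *%R ustar (fun x => Normc.normc (x.2 : R[i])).
Proof.
split; first split.
- by move=> x; apply: normc_ge0.
- by move=> x y; apply: le_normcD.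
- by move=> c x; rewrite /= Normc.normcM.
- by move=> x y; rewrite /= Normc.normcM.
- by move=> x; rewrite /= Normc.normcM normc_conj expr2.
Qed.

Lemma unorm_cstar : cstar_seminorm (A := U) *%R ustar unorm.
Proof.
exact: (cstar_seminorm_max ustar_algebra opnorm_cstar snd_cstar).
Qed.

Lemma unorm_snd x : Normc.normc (x.2 : R[i]) <= unorm x.
Proof. by rewrite le_max lexx orbT. Qed.

(** The upper bound is submultiplicativity; the lower one comes from testing on [star a], as
    [p (mul a (star a)) = p a ^+ 2]. *)
Lemma unorm_uin a : unorm (uin a) = p a.
Proof.
rewrite /unorm Normc.normc0 max_l ?opnorm_ge0 //.
have uE y : uact (uin a) y = mul a y by rewrite /uact /= scale0r addr0.
apply/le_anti/andP; split.
  apply: opnorm_le => y y1; rewrite uE; apply: le_trans (pM _ _) _; exact: ler_piMr.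
have [-> |na] := eqVneq (p a) 0; first exact: opnorm_ge0.
have a0 : 0 < p a by rewrite lt_neqAle eq_sym na p_ge0.
have := p_uact (uin a) (star a); rewrite uE -{1}(starK hA a) pC !(snorm_star hA hp).
by rewrite expr2 ler_pM2r.
Qed.

Lemma unorm_fst (x : U) : p x.1 <= 2 * unorm x.
Proof.
have [us uM _] := unorm_cstar.
have q0 : unorm 1 <= 1 := q1_le1 ustar_algebra unorm_cstar.
have -> : p x.1 = unorm (x - (x.2 : R[i]) *: 1).
  rewrite -unorm_uin; congr unorm; congr pair; rewrite /= ?scaler0 ?subr0 //.
  by rewrite -[X in _ = _ - X]/(x.2 * 1) mulr1 subrr.
apply: le_trans (ler_snormB us _ _) _.
have [_ _ ->] := us; have := unorm_snd x; have := normc_ge0 x.2.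
have := snorm_ge0 us 1; nra.
Qed.

(** Iterates the C*-inequality on one fixed [y]. No supremum over [y] enters the bound, so [p] can
    afterwards be replaced by a larger seminorm. *)
Lemma p_uact_exp2 (x : U) y k : p y <= 1 ->
  p (uact x y) ^+ (2 ^ k.+1) <= p (uact ((ustar x * x) ^+ (2 ^ k)) y).
Proof.
move=> y1.
have step z : p (uact z y) ^+ 2 <= p (uact (ustar z * z) y).
  rewrite -pC star_uact -uactM; apply: le_trans (pM _ _) _; rewrite (snorm_star hA hp).
  exact: ler_piMl.
elim: k => [|k IH]; first by rewrite expr1 -[(2 ^ 1)%N]/2%N.
rewrite expnSr exprM; set h := ustar x * x.
apply: (@le_trans _ _ (p (uact (h ^+ (2 ^ k)) y) ^+ 2)).
  by rewrite ler_pXn2r ?nnegrE ?exprn_ge0.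
apply: le_trans (step _) _.
have -> : ustar (h ^+ (2 ^ k)) = h ^+ (2 ^ k).
  by apply: (saX ustar_algebra); apply: (sa_starM ustar_algebra).
by rewrite -expr2 -exprM -expnSr.
Qed.
End Norm.

(* The supremum defining [opnorm p] runs over a set that depends on [p], so that
   monotonicity in [p] needs the spectral radius formula. *)
Lemma opnorm_mono (p p' : A -> R) : cstar_seminorm mul star p ->
  cstar_seminorm mul star p' -> (forall a, p a <= p' a) ->
  forall x, opnorm p x <= opnorm p' x.
Proof.
move=> hp hp' pp' x; apply: (opnorm_le hp) => y y1.
have [sp _ _] := hp; have [sp' _ _] := hp'; have [so oM oC] := opnorm_cstar hp'.
have o0 := opnorm_ge0 hp' x; have p0 := snorm_ge0 sp (uact x y).
apply/ler_addgt0Pr => e e0.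
rewrite -(@ler_pXn2r _ 2) ?nnegrE ?addr_ge0 ?(ltW e0) //.
apply: (@le_of_sqr_powers _ _ _ (p' y)); rewrite ?exprn_ge0 ?exprn_gt0 ?ltr_wpDl //.
  exact: (snorm_ge0 sp').
move=> k; rewrite -!exprM -expnS.
apply: le_trans (p_uact_exp2 hp x k y1) _; apply: le_trans (pp' _) _.
apply: le_trans (p_uact hp' _ _) _.
apply: ler_pM; rewrite ?(opnorm_ge0 hp') ?(snorm_ge0 sp') //.
  apply: le_trans (qX_le (opnorm_cstar hp') _ _) _; first by rewrite expn_gt0.
  rewrite oC -exprM -expnS lerXn2r ?nnegrE ?addr_ge0 ?(ltW e0) // lerDl ltW //.
have : 1 <= (2 ^ k)%:R :> R by rewrite ler1n expn_gt0.
by move/(ler_wpM2r (snorm_ge0 sp' y)); lra.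
Qed.

Lemma unorm_mono (p p' : A -> R) : cstar_seminorm mul star p ->
  cstar_seminorm mul star p' -> (forall a, p a <= p' a) ->
  forall x, unorm p x <= unorm p' x.
Proof.
move=> hp hp' pp' x; rewrite ge_max !le_max lexx orbT andbT.
by rewrite (opnorm_mono hp hp' pp').
Qed.
End Unitization.

(** * Square roots in pro-C*-algebras *)

Section ProCstar.
Variables (R : realType) (A : lmodType R[i]) (mul : A -> A -> A) (star : A -> A).
Variable S : (A -> R) -> Prop.
Hypothesis hP : pro_cstar mul star S.
Let hA := pc_alg hP.
Local Notation U := (unitization hA).
Local Notation posU p := (@pos R U (@ustar _ _ _ _ hA) (@unorm _ _ _ _ hA p)).
Let hU := ustar_algebra hA.
Let hc p (Sp : S p) := pc_cstar hP Sp.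
Let hq p (Sp : S p) := unorm_cstar hA (hc Sp).

(** The maximum is dominated by [p + p'], so saturation puts it in [S]; this makes [S] directed. *)
Lemma pro_cstar_max p p' : S p -> S p' -> S (fun a => Num.max (p a) (p' a)).
Proof.
move=> Sp Sp'; apply: (pc_saturated hP).
  by apply: (cstar_seminorm_max hA); apply: hc.
exists 2%N, (fun i : 'I_2 => if i == ord0 then p else p'), 1; split.
  by move=> i; case: ifP.
move=> a; rewrite mul1r !big_ord_recl big_ord0 /= addr0.
have p0 := snorm_ge0 (let: And3 s _ _ := hc Sp in s) a.
have p0' := snorm_ge0 (let: And3 s _ _ := hc Sp' in s) a.
by rewrite ge_max lerDl p0' lerDr p0.
Qed.

Lemma posU_mono p p' x : S p -> S p' -> (forall a, p a <= p' a) -> posU p' x -> posU p x.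
Proof.
move=> Sp Sp' pp' [sx [t [t0 ht]]]; split=> //; exists t; split=> //.
by apply: le_trans ht; apply: unorm_mono => //; apply: hc.
Qed.

Lemma posU_starM p b : S p -> posU p (uin hA (mul (star b) b)).
Proof.
by move=> Sp; rewrite uinM -ustar_uin; apply: pos_starM => //; apply: hq.
Qed.

(** * The net of approximate square roots *)

Section SquareRoot.
Variable h : A.
Hypothesis hpos : forall p, S p -> posU p (uin hA h).

(** Indexing the net by the roots themselves, with seminorm and precision, avoids choosing one root
    for each pair. The commutation clause makes any two of them commute. *)
Definition is_root (i : (A -> R) * nat * U) : Prop :=
  let: (p, n, u) := i in
  [/\ S p, posU p u, forall y : U, y * uin hA h = uin hA h * y -> y * u = u * y &
    unorm p (uin hA h - u * u) <= n.+1%:R^-1].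

Definition root_index := {i | is_root i}.
Definition root_le (i j : root_index) : Prop :=
  (forall a, (sval i).1.1 a <= (sval j).1.1 a) /\ ((sval i).1.2 <= (sval j).1.2)%N.

Lemma root_exists p n : S p -> exists u, is_root (p, n, u).
Proof.
move=> Sp; have n0 : 0 < n.+1%:R^-1 :> R by rewrite invr_gt0.
have [u [pu uc hu]] := approx_sqrt hU (hq Sp) (hpos Sp) n0.
by exists u; split.
Qed.

Lemma root_le_refl i : root_le i i. Proof. by []. Qed.

Lemma root_le_trans i j k : root_le i j -> root_le j k -> root_le i k.
Proof.
move=> [ij1 ij2] [jk1 jk2]; split; last exact: leq_trans jk2.
by move=> a; apply: le_trans (jk1 a).
Qed.

Lemma root_directed i j : exists k, root_le i k /\ root_le j k.
Proof.
case: i j => [[[p n] u] hi] [[[p' n'] u'] hj].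
have [[Sp _ _ _] [Sp' _ _ _]] := (hi, hj).
have [v hv] := root_exists (maxn n n') (pro_cstar_max Sp Sp').
exists (exist _ _ hv); split; split; rewrite /= ?leq_maxl ?leq_maxr // => a.
  by rewrite le_max lexx.
by rewrite le_max lexx orbT.
Qed.

Lemma root_above p n u (hi : is_root (p, n, u)) j : root_le (exist _ _ hi) j ->
  [/\ posU p (sval j).2,
     forall y : U, y * uin hA h = uin hA h * y -> y * (sval j).2 = (sval j).2 * y &
     unorm p (uin hA h - (sval j).2 * (sval j).2) <= n.+1%:R^-1].
Proof.
case: j => [[[p' n'] v] hj] [/= pp' nn'].
have [[Sp _ _ _] [Sp' pv vc hv]] := (hi, hj); split=> //; first exact: posU_mono pv.
apply: le_trans (unorm_mono (hc Sp) (hc Sp') pp' _) _; apply: le_trans hv _.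
by rewrite lef_pV2 ?posrE ?ltr0n // ler_nat.
Qed.

(** Completeness holds in [A], so only the first coordinate is followed; the scalar one tends to
    [0]. *)
Definition root_part (i : root_index) : A := (sval i).2.1.

Lemma root_cauchy p : S p -> forall e : R, 0 < e -> exists i0, forall i j,
  root_le i0 i -> root_le i0 j -> p (root_part i - root_part j) < e.
Proof.
move=> Sp e e0.
(* With [1 / n.+1 < e ^+ 2 / 8], the roots differ by less than [e / 2] in [unorm p], and passing to
   [A] costs a factor [2]. *)
have [n hn] := exists_small_inv (divr_gt0 (exprn_gt0 2 e0) (ltr0Sn R 7)).
have [u hi] := root_exists n Sp; exists (exist _ _ hi) => i j.
move=> /root_above[pi ci hi1] /root_above[pj cj hj1].
have [us _ _] := hq Sp.
set v := (sval i).2 in pi ci hi1 *; set w := (sval j).2 in pj cj hj1 *.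
have vw : v * w = w * v by apply: cj; symmetry; apply: ci.
have h1 := sqr_norm_le hU (hq Sp) pi pj vw.
have h2 : unorm p (v * v - w * w) <= n.+1%:R^-1 + n.+1%:R^-1.
  apply: le_trans (ler_snorm_distD us (uin hA h) _ _) _.
  by rewrite (snormB us); apply: lerD.
have h3 := @unorm_fst _ _ _ _ hA _ (hc Sp) (v - w).
have h0 := snorm_ge0 us (v - w).
apply: le_lt_trans h3 _.
rewrite -(@ltr_pXn2r _ 2) ?nnegrE ?mulr_ge0 ?(ltW e0) //.
rewrite exprMn; move: (le_trans h1 h2) hn.
by move: (n.+1%:R^-1) (unorm p (v - w) ^+ 2) => a b; lra.
Qed.

Lemma sqrt_exists : positive mul star h.
Proof.
(* If [S] is empty the net has no index, but then the Hausdorff axiom makes [A] trivial. *)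
have [[p0 Sp0]|nS] := pselect (exists p, S p); last first.
  have a0 (a : A) : a = 0 by apply: (pc_hausdorff hP) => p Sp; case: nS; exists p.
  by exists 0; rewrite (a0 h) [RHS]a0.
have [u0 hu0] := root_exists 0 Sp0.
have [l hl] := pc_complete hP (inhabits (exist _ _ hu0 : root_index)) root_le_refl
  root_le_trans root_directed root_cauchy.
exists l; apply/eqP; rewrite eq_sym -subr_eq0; apply/eqP.
apply: (pc_hausdorff hP) => p Sp; have [sp _ _] := hc Sp.
apply/le_anti; rewrite snorm_ge0 // andbT; apply/ler_addgt0Pr => e e0; rewrite add0r.
have [us uM uC] := hq Sp; have u_star := snorm_star hU (hq Sp).
set L := p l; have L0 : 0 <= L by apply: snorm_ge0.
(* The total error is at most [2 d L + 2 d (L + 2 d) + d ^+ 2], hence at most [d (4 L + 5)] for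
   [d <= 1]. *)
have C0 : 0 < 4 * L + 5 by lra.
pose d := Num.min 1 (e / (4 * L + 5)).
have d0 : 0 < d by rewrite lt_min ltr01 divr_gt0.
have d1 : d <= 1 by rewrite ge_min lexx.
have dC : d * (4 * L + 5) <= e by rewrite -ler_pdivlMr // ge_min lexx orbT.
have [i0 hi0] := hl p Sp d d0.
have [n hn] := exists_small_inv (exprn_gt0 2 d0).
have [u1 hu1] := root_exists n Sp.
have [i [i0i i1i]] := root_directed i0 (exist _ _ hu1).
have := hi0 i i0i; have [[su _] _] := root_above i1i.
set u := (sval i).2 => hu /ltW hx; have {}su : ustar u = u := su.
(* The scalar coordinate of [uin hA h] is [0], so that of [u * u] is at most [d ^+ 2] in modulus. *)
have uz : Normc.normc (u.2 : R[i]) <= d.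
  rewrite -(@ler_pXn2r _ 2) ?nnegrE ?normc_ge0 ?(ltW d0) // expr2 -Normc.normcM.
  apply: le_trans (ltW hn); apply: le_trans hu.
  by have := unorm_snd hA p (uin hA h - u * u); rewrite /= add0r normcN.
have q1 : unorm p 1 <= 1 := q1_le1 hU (hq Sp).
have ul : unorm p (uin hA l - u) <= 2 * d.
  have -> : uin hA l - u = uin hA (l - u.1) - (u.2 : R[i]) *: 1.
    congr pair; rewrite /= ?scaler0 ?subr0 // sub0r.
    by rewrite -[X in _ = _ - X]/(u.2 * 1) mulr1 sub0r.
  apply: le_trans (ler_snormB us _ _) _; rewrite (unorm_uin hA (hc Sp)) (snormB sp).
  have [_ _ ->] := us; have := normc_ge0 (u.2 : R[i]); have := snorm_ge0 us 1; nra.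
have uL : unorm p (uin hA l) = L by apply: unorm_uin; apply: hc.
rewrite -(unorm_uin hA (hc Sp)) uinB uinM -ustar_uin.
set l' := uin hA l in ul uL *.
have -> : ustar l' * l' - uin hA h =
   ustar l' * (l' - u) + ustar (l' - u) * u - (uin hA h - u * u).
  by rewrite (starB hU) su; ncring.
have uu : unorm p u <= L + 2 * d.
  by apply: le_trans (ler_snorm_shift us _ l') _; rewrite uL (snormB us) lerD2l.
have e1 : unorm p (ustar l' * (l' - u)) <= L * (2 * d).
  apply: le_trans (uM _ _) _; rewrite u_star uL; exact: ler_wpM2l.
have e2 : unorm p (ustar (l' - u) * u) <= 2 * d * (L + 2 * d).
  by apply: le_trans (uM _ _) _; rewrite u_star; apply: ler_pM => //; apply: snorm_ge0 us _.
have dd : d ^+ 2 <= d by rewrite expr2; apply: ler_piMr => //; apply: ltW.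
have e3 : unorm p (uin hA h - u * u) <= d ^+ 2 by apply: le_trans hu (ltW hn).
apply: le_trans (ler_snormB us _ _) _; apply: le_trans (lerD (ler_snormD us _ _) e3) _.
by apply: le_trans (lerD (lerD e1 e2) dd) _; lra.
Qed.
End SquareRoot.
End ProCstar.

(** * Adjoints on Hilbert modules *)

Section HilbertModules.
Variables (R : realType) (A : lmodType R[i]) (mul : A -> A -> A) (star : A -> A).
Variable S : (A -> R) -> Prop.
Hypothesis hA : star_algebra mul star.
Local Notation U := (unitization hA).
Variables (X Y : lmodType R[i]) (actX : A -> X -> X) (ipX : X -> X -> A).
Variables (actY : A -> Y -> Y) (ipY : Y -> Y -> A).
Hypotheses (hX : hilbert_module mul star S actX ipX) (hY : hilbert_module mul star S actY ipY).

Lemma ipBl x y w : ipY (x - y) w = ipY x w - ipY y w.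
Proof. by rewrite (ipDl hY) -scaleN1r (ipZl hY) scaleN1r. Qed.

Lemma uin_uact (d : U) a : uin hA (uact d a) = d * uin hA a.
Proof. by congr pair; rewrite /= ?scale0r ?addr0 ?mulr0. Qed.

Definition umod (d : U) (y : Y) : Y := actY d.1 y + d.2 *: y.

Lemma ip_umod d y w : ipY (umod d y) w = uact d (ipY y w).
Proof. by rewrite (ipDl hY) (ipAl hY) (ipZl hY). Qed.

Variables (T : X -> Y) (Ts : Y -> X).
Hypothesis hTs : is_adjoint ipX ipY T Ts.

Lemma adjoint_ipl y x : ipX (Ts y) x = ipY y (T x).
Proof. by rewrite -(ip_star hX) -hTs (ip_star hY). Qed.

(** Moving [Ts] across the inner product shows its module linearity against every [x]. So replacing
    [y] by [umod d y] conjugates the inner square of [Ts y] by [d]. *)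
Lemma ip_adjoint_umod d y :
  uin hA (ipX (Ts (umod d y)) (Ts (umod d y))) = d * uin hA (ipX (Ts y) (Ts y)) * ustar d.
Proof.
have E x : ipX (Ts (umod d y)) x = uact d (ipX (Ts y) x).
  by rewrite !adjoint_ipl ip_umod.
rewrite E uin_uact -(ip_star hX) E -ustar_uin uin_uact (Defs.starM (ustar_algebra hA)).
by rewrite ustar_uin (ip_star hX) mulrA.
Qed.
End HilbertModules.

(** * Equivalence of the operator order and the seminorm inequalities *)

Theorem theorem2p8 (R : realType) (A : lmodType R[i]) (mul : A -> A -> A)
  (star : A -> A) (S : (A -> R) -> Prop) (hA : pro_cstar mul star S)
  (X Y : lmodType R[i]) (actX : A -> X -> X) (ipX : X -> X -> A)
  (actY : A -> Y -> Y) (ipY : Y -> Y -> A)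
  (hX : hilbert_module mul star S actX ipX)
  (hY : hilbert_module mul star S actY ipY)
  (T L : X -> Y) (Ts Ls : Y -> X)
  (hT : hom_star S actX ipX actY ipY T) (hL : hom_star S actX ipX actY ipY L)
  (hTs : is_adjoint ipX ipY T Ts) (hLs : is_adjoint ipX ipY L Ls) :
  op_le mul star ipY (fun y => T (Ts y)) (fun y => L (Ls y)) <->
  (forall (y : Y) (p : A -> R), S p -> hnorm ipX p (Ts y) <= hnorm ipX p (Ls y)).
Proof.
have hU := ustar_algebra (pc_alg hA).
have hq p (Sp : S p) := unorm_cstar (pc_alg hA) (pc_cstar hA Sp).
have p_ge0 p (Sp : S p) a : 0 <= p a by have [s _ _] := pc_cstar hA Sp; apply: snorm_ge0.
have hnormE p (Sp : S p) x x' :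
    (hnorm ipX p x <= hnorm ipX p x') = (p (ipX x x) <= p (ipX x' x')).
  by rewrite ler_sqrt // p_ge0.
have opE y : ipY (L (Ls y) - T (Ts y)) y = ipX (Ls y) (Ls y) - ipX (Ts y) (Ts y).
  by rewrite (ipBl hY) hTs hLs.
have ppos p (Sp : S p) a : positive mul star a ->
    pos (ustar (hA := pc_alg hA)) (unorm p) (uin (pc_alg hA) a).
  by move=> [b ->]; apply: posU_starM.
split=> [H y p Sp|H y].
  rewrite hnormE // -!(unorm_uin (pc_alg hA) (pc_cstar hA Sp)).
  apply: (pos_le_norm hU (hq p Sp)); first by apply: ppos => //; apply: ip_pos hX _.
  by rewrite -uinB -opE; apply: ppos => //; apply: H.
rewrite opE; apply: (sqrt_exists (hP := hA)) => p Sp; rewrite uinB.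
apply: (pos_sub_of_conj_norm hU (hq p Sp)); try by apply: ppos => //; apply: ip_pos hX _.
(* The seminorm inequality at [umod d y] is exactly the comparison of the conjugates by [d]. *)
move=> d; rewrite -(ip_adjoint_umod hX hY hTs) -(ip_adjoint_umod hX hY hLs).
by rewrite !(unorm_uin _ (pc_cstar hA Sp)) -hnormE //; apply: H.
Qed.
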